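(* There is no algorithm which, given a finite class table (obeying Java's prohibition of multiple instantiation inheritance) and two ground types $t$ and $t'$, decides whether $t \le t'$ holds according to that class table. That is, subtype checking is undecidable.
   Context: This is a formalization of a fragment of Java's type system (generic classes whose type parameters are used contravariantly, as with Java's ''? super'' wildcards). There is a set of classes, each with an arity $\ge 0$, and a set of type variables. Types are defined inductively: every type variable $x$ is a type; if $C$ is a class of arity $m \ge 0$ and $t_1,\dots,t_m$ are types, then $C t_1 \dots t_m$ is a type. A type is ground if it contains no type variables. A substitution $\sigma$ maps finitely many type variables to types; $t\sigma$ denotes the result of applying it. A class table is a finite set of inheritance rules of the form $C x_1 \dots x_m \lhd D t_1 \dots t_n$, where $m$ is the arity of $C$, $n$ is the arity of $D$, $x_1,\dots,x_m$ are type variables, and every type variable occurring in $t_1,\dots,t_n$ is among $x_1,\dots,x_m$. A class table defines a binary relation $\lhd$ on types: if $t_L \lhd t_R$ is an inheritance rule then $t_L\sigma \lhd t_R\sigma$ for every substitution $\sigma$. Let $\lhd^*$ be its reflexive transitive closure. The class table has no multiple instantiation inheritance (a restriction Java imposes) if whenever $t \lhd^* C t_1\dots t_m$ and $t \lhd^* C t'_1 \dots t'_m$ we have $t_i = t'_i$ for all $i$. The subtyping relation $\le$ is the relation defined inductively by the single rule: if $A t_1\dots t_m \lhd^* C t'_1 \dots t'_n$ and $t''_i \le t'_i$ for all $1\le i\le n$, then $A t_1 \dots t_m \le C t''_1 \dots t''_n$ (so type arguments are contravariant). *)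

(* Defs.v *)
From HB Require Import structures.
From mathcomp Require Import all_boot.

Set Implicit Arguments.
Unset Strict Implicit.
Unset Printing Implicit Defensive.

Inductive ty : Type :=
| TVar : nat -> ty
| TApp : nat -> seq ty -> ty.

Fixpoint ty_enc (t : ty) : GenTree.tree nat :=
  match t with
  | TVar x => GenTree.Leaf x
  | TApp C ts => GenTree.Node C (map ty_enc ts)
  end.

Fixpoint ty_dec (g : GenTree.tree nat) : ty :=
  match g with
  | GenTree.Leaf x => TVar x
  | GenTree.Node C gs => TApp C (map ty_dec gs)
  end.

Fixpoint ty_encK (t : ty) : ty_dec (ty_enc t) = t :=
  match t return ty_dec (ty_enc t) = t with
  | TVar x => erefl
  | TApp C ts => f_equal (TApp C)
      ((fix F (ts : seq ty) : map ty_dec (map ty_enc ts) = ts :=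
          match ts return map ty_dec (map ty_enc ts) = ts with
          | [::] => erefl
          | u :: us => f_equal2 cons (ty_encK u) (F us)
          end) ts)
  end.

HB.instance Definition _ := Countable.copy ty (can_type ty_encK).

Fixpoint tvars (t : ty) : seq nat :=
  match t with
  | TVar x => [:: x]
  | TApp _ ts => flatten (map tvars ts)
  end.

Definition ground (t : ty) : bool := nilp (tvars t).

(* applying a substitution (a map from type variables to types; only its
   values on the finitely many variables of the type matter) *)
Fixpoint subst (s : nat -> ty) (t : ty) : ty :=
  match t with
  | TVar x => s x
  | TApp C ts => TApp C (map (subst s) ts)
  end.

Definition arities := seq nat.

Definition is_class (ar : arities) (C : nat) : bool := C < size ar.
Definition arity (ar : arities) (C : nat) : nat := nth 0 ar C.

Fixpoint wf (ar : arities) (t : ty) : bool :=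
  match t with
  | TVar _ => true
  | TApp C ts => [&& is_class ar C, size ts == arity ar C & all (wf ar) ts]
  end.

(* An inheritance rule  C x_1 .. x_m <| D t_1 .. t_n  is represented  *)
(* by the tuple (C, [:: x_1; ..; x_m], D, [:: t_1; ..; t_n]).          *)
Definition rule := (nat * seq nat * nat * seq ty)%type.

Definition rule_lhs (r : rule) : ty := TApp r.1.1.1 (map TVar r.1.1.2).
Definition rule_rhs (r : rule) : ty := TApp r.1.2 r.2.

Definition wf_rule (ar : arities) (r : rule) : bool :=
  [&& is_class ar r.1.1.1,
      size r.1.1.2 == arity ar r.1.1.1,
      uniq r.1.1.2,
      wf ar (rule_rhs r) &
      all (fun x => x \in r.1.1.2) (tvars (rule_rhs r))].

Definition class_table := seq rule.

Definition wf_table (ar : arities) (CT : class_table) : bool :=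
  all (wf_rule ar) CT.

Definition inh (ar : arities) (CT : class_table) (t u : ty) : Prop :=
  wf ar t /\
  exists (r : rule) (s : nat -> ty),
    r \in CT /\ t = subst s (rule_lhs r) /\ u = subst s (rule_rhs r).

Inductive inh_star (ar : arities) (CT : class_table) : ty -> ty -> Prop :=
| inh_refl t : inh_star ar CT t t
| inh_step t u v : inh ar CT t u -> inh_star ar CT u v -> inh_star ar CT t v.

Definition no_MII (ar : arities) (CT : class_table) : Prop :=
  forall (t : ty) (C : nat) (ts ts' : seq ty),
    wf ar t ->
    inh_star ar CT t (TApp C ts) -> inh_star ar CT t (TApp C ts') -> ts = ts'.

Inductive subtype (ar : arities) (CT : class_table) : ty -> ty -> Prop :=
| subtype_rule (A : nat) (ts : seq ty) (C : nat) (ts' ts'' : seq ty) :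
    inh_star ar CT (TApp A ts) (TApp C ts') ->
    size ts'' = size ts' ->
    (forall i, i < size ts' ->
        subtype ar CT (nth (TVar 0) ts'' i) (nth (TVar 0) ts' i)) ->
    subtype ar CT (TApp A ts) (TApp C ts'').

Definition instance := (arities * class_table * ty * ty)%type.

Definition valid_instance (I : instance) : Prop :=
  let: (ar, CT, t, t') := I in
  [/\ wf_table ar CT, no_MII ar CT,
      wf ar t && ground t & wf ar t' && ground t'].

Definition subtype_holds (I : instance) : Prop :=
  let: (ar, CT, t, t') := I in subtype ar CT t t'.

(* instances are encoded as natural numbers by the (computable, injective)
   canonical encoding of the countable type [instance] *)
Definition encode (I : instance) : nat := pickle I.

(* Model of computation: Minsky register (counter) machines.           *)
Inductive instr : Type :=
| INC : nat -> nat -> instr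
| DEC : nat -> nat -> nat -> instr.

Definition program := seq instr.
Definition config := (nat * seq nat)%type.

Definition reg (regs : seq nat) (r : nat) : nat := nth 0 regs r.

Definition mstep (P : program) (c : config) : config :=
  let: (pc, regs) := c in
  if pc < size P then
    match nth (INC 0 0) P pc with
    | INC r j => (j, set_nth 0 regs r (reg regs r).+1)
    | DEC r j k =>
        if reg regs r is n.+1 then (j, set_nth 0 regs r n) else (k, regs)
    end
  else c.

(* P, started with input n in register 0 (all other registers 0),
   halts with value v in register 0 *)
Definition halts_with (P : program) (n v : nat) : Prop :=
  exists k : nat,
    let c := iter k (mstep P) (0, [:: n]) in
    size P <= c.1 /\ reg c.2 0 = v.

Definition decides_subtyping (P : program) : Prop :=
  forall I : instance, valid_instance I ->
    (subtype_holds I -> halts_with P (encode I) 1) /\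
    (~ subtype_holds I -> halts_with P (encode I) 0).

(* Main.v *)
(* A goal between two unary types is a pair of stacks.
   With rules g x <| V_q (V_q' (p x)) the goal  g a <= V_q b  reduces, because
   type arguments are contravariant, to  b <= V_q' (p a): pop a symbol from the
   left stack, change state, push a word, exchange the stacks.  Classes on the
   right of a rule never occur on the left of one and each pair (g, V_q) has one
   rule, so there is no multiple instantiation, and two stacks simulate a Minsky
   machine by storing its registers in unary on the left one and moving across
   them.  Hence every machine P and input n yield types that are in the subtype
   relation exactly when P halts on n.

   For the diagonal argument, only the right-hand type depends on n.  From a
   decider P one builds the machine D that on input n computes the code of the
   instance whose class table is coded by n, with the right-hand type for n, runs
   P on it, and halts iff P answers 0.  Fed with the code of its own class table,
   D halts iff the corresponding types are not subtypes, i.e. iff it does not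
   halt. *)
Require Import Defs.
From mathcomp Require Import all_boot.
From Stdlib Require Import FunctionalExtensionality.

Set Implicit Arguments.
Unset Strict Implicit.
Unset Printing Implicit Defensive.

(** * Two-stack automata as class tables *)

Definition word_ty (w : seq nat) (t : ty) : ty :=
  foldr (fun g u => TApp g.+1 [:: u]) t w.

(* Class 0 ends a stack, class g.+1 is the stack symbol g < 3, class 4 accepts,
   and the classes from 5 on are the states. *)
Definition bottom_ty : ty := TApp 0 [::].
Definition accept_ty : ty := TApp 4 [::].

Lemma word_ty_cat (v w : seq nat) (t : ty) :
  word_ty (v ++ w) t = word_ty v (word_ty w t).
Proof. exact: foldr_cat. Qed.

Lemma subst_word_ty (s : nat -> ty) (w : seq nat) (t : ty) :
  subst s (word_ty w t) = word_ty w (subst s t).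
Proof. by elim: w => //= g w ->. Qed.

Lemma tvars_word_ty (w : seq nat) (t : ty) : tvars (word_ty w t) = tvars t.
Proof. by elim: w => //= g w ->; rewrite cats0. Qed.

Definition symbols (w : seq nat) : bool := all (fun g => g < 3) w.

Section Automaton.

Context (Q : eqType) (states : seq Q) (delta : nat -> Q -> option (Q * seq nat)).

Definition state_class (q : Q) : nat := 5 + index q states.

Definition state_ty (q : Q) (t : ty) : ty := TApp (state_class q) [:: t].

Definition move_ty (o : option (Q * seq nat)) (t : ty) : ty :=
  if o is Some (q, p) then state_ty q (word_ty p t) else accept_ty.

Definition accept_rule (g : nat) : rule := (g.+1, [:: 0], 4, [::]).
Definition move_rule (g : nat) (q : Q) : rule :=
  (g.+1, [:: 0], state_class q, [:: move_ty (delta g q) (TVar 0)]).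

Definition table : class_table :=
  [seq accept_rule g | g <- iota 0 3] ++
  [seq move_rule g q | g <- iota 0 3, q <- states].

Definition table_arities : arities := [:: 0; 1; 1; 1; 0] ++ nseq (size states) 1.

(** The stacks change roles at every step, and the number bounds the steps. When [delta] gives no
    move, the other stack must be nonempty, since [accept_rule] exists for stack symbols but not for
    the bottom class. *)
Fixpoint accepts (n : nat) (c : seq nat * Q * seq nat) : bool :=
  if n is n'.+1 then
    if c is (g :: a, q, b) then
      if delta g q is Some (q', p) then accepts n' (b, q', p ++ a)
      else b != [::]
    else false
  else false.

Hypothesis deltaP : forall g q, g < 3 -> q \in states ->
  if delta g q is Some (q', p) then (q' \in states) && (symbols p) else true.

Lemma accepts_leq (m n : nat) c : m <= n -> accepts m c -> accepts n c.
Proof.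
elim: m n c => [|m IHm] [|n] [[[|g a] q] b] //= le_mn.
by case: (delta g q) => [[q' p]|] //; apply: IHm.
Qed.

Lemma subst_move_ty (s : nat -> ty) o t :
  subst s (move_ty o t) = move_ty o (subst s t).
Proof. by case: o => [[q p]|] //=; rewrite subst_word_ty. Qed.

Lemma inh_tableP t u : inh table_arities table t u ->
  exists g x, [/\ g < 3, t = TApp g.+1 [:: x] &
    u = accept_ty \/
    exists2 q, q \in states & u = state_ty q (move_ty (delta g q) x)].
Proof.
case=> _ [r [s [r_in [-> ->]]]].
move: r_in; rewrite mem_cat => /orP[/mapP|/allpairsP].
  case=> g; rewrite mem_iota => /= lt_g3 ->.
  by exists g, (s 0); split=> //; left.
case=> -[g q] [+ q_in ->]; rewrite mem_iota => /= g_in; rewrite /= in q_in.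
exists g, (s 0); split=> //; right; exists q => //.
by rewrite /subst /= -/(subst _) subst_move_ty.
Qed.

(** Classes on the left of rules are 1 to 3 and those on the right are 4 and above, so two
    inheritance steps never compose. *)
Lemma inh_star_tableP t u : inh_star table_arities table t u ->
  t = u \/ inh table_arities table t u.
Proof.
case=> [{}t|{}t v {}u tv vu]; [by left | right].
case: vu tv => [//|{}v w {}u /inh_tableP[g [x [lt_g3 -> _]]] _].
case/inh_tableP=> g' [x' [_ _ [[eg]|[q _ [eg]]]]]; move: lt_g3.
  by rewrite eg.
by rewrite eg.
Qed.

Lemma state_class_inj q q' :
  q \in states -> q' \in states -> state_class q = state_class q' -> q = q'.
Proof.
move=> qs q's /addnI eq_i; rewrite -(nth_index q qs) eq_i.
by rewrite (nth_index q q's).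
Qed.

(** Chains have at most one step and no step keeps the class. For single steps the class determines
    the state, and symbol and state determine the move. *)
Lemma no_MII_table : no_MII table_arities table.
Proof.
have inhF C ts ts' : inh table_arities table (TApp C ts) (TApp C ts') -> False.
  case/inh_tableP=> g [x [lt_g3 [-> _]]].
  by case=> [[eg]|[q _ [eg]]]; rewrite eg in lt_g3.
move=> t C ts ts' _ /inh_star_tableP[->|tC] /inh_star_tableP[[//]|].
- by move/inhF.
- by move=> et; move: tC; rewrite et => /inhF.
case/inh_tableP: tC => g [x [lt_g3 -> eC]].
case/inh_tableP=> g' [x' [_ [<- <-]]].
case: eC => [[-> ->]|[q qs [-> ->]]]; first by case=> [[->]|[q' _ []]].
case=> [[eq_c _]|[q' q's [eq_c ->]]]; first by move/eqP: eq_c.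
by rewrite (state_class_inj qs q's) //; apply: (congr1 (addn 5) eq_c).
Qed.

Lemma wf_symbol_ty g x : g < 3 ->
  wf table_arities x -> wf table_arities (TApp g.+1 [:: x]).
Proof. by case: g => [|[|[]]] //= _ ->. Qed.

Lemma wf_word_ty w t : symbols w ->
  wf table_arities t -> wf table_arities (word_ty w t).
Proof.
move=> w_sym wf_t; elim: w w_sym => // g w IHw /andP[lt_g3 /IHw].
exact: wf_symbol_ty.
Qed.

Lemma wf_state_ty q t : q \in states ->
  wf table_arities t -> wf table_arities (state_ty q t).
Proof.
move=> qs /= ->; rewrite /is_class /arity /= size_nseq !ltnS index_mem qs.
by rewrite nth_nseq index_mem qs.
Qed.

Lemma wf_table_table : wf_table table_arities table.
Proof.
apply/allP=> r; rewrite mem_cat => /orP[/mapP|/allpairsP].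
  by case=> g; rewrite mem_iota => /= lt_g3 ->; case: g lt_g3 => [|[|[]]].
case=> -[g q] [+ qs ->]; rewrite mem_iota => /= g_in; rewrite /= in qs.
have wf_mv : wf table_arities (move_ty (delta g q) (TVar 0)).
  case: (delta g q) (deltaP g_in qs) => [[q' p]|] //= /andP[q's p_sym].
  by apply: wf_state_ty => //; apply: wf_word_ty.
apply/and5P; split=> //.
- by rewrite /is_class /=; case: g g_in {wf_mv} => [|[|[]]].
- by rewrite /arity /=; case: g g_in {wf_mv} => [|[|[]]].
- exact: (wf_state_ty qs wf_mv).
rewrite /= cats0; case: (delta g q) => [[q' p]|] //=.
by rewrite tvars_word_ty.
Qed.

Lemma subtype_move g q x y : g < 3 -> q \in states -> wf table_arities x ->
  subtype table_arities table y (move_ty (delta g q) x) ->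
  subtype table_arities table (TApp g.+1 [:: x]) (state_ty q y).
Proof.
move=> lt_g3 qs wf_x sub_y.
apply: (@subtype_rule _ _ _ _ _ [:: move_ty (delta g q) x]) => [|//|[|//] _ //].
apply: inh_step (inh_refl _ _ _); split.
  exact: wf_symbol_ty.
exists (move_rule g q), (fun=> x); split.
  rewrite mem_cat; apply/orP; right; apply/allpairsP; exists (g, q).
  by rewrite mem_iota.
by rewrite /= subst_move_ty.
Qed.

Lemma subtype_accept g x : g < 3 -> wf table_arities x ->
  subtype table_arities table (TApp g.+1 [:: x]) accept_ty.
Proof.
move=> lt_g3 wf_x; apply: (@subtype_rule _ _ _ _ _ [::]) => //.
apply: inh_step (inh_refl _ _ _); split.
  exact: wf_symbol_ty.
exists (accept_rule g), (fun=> x); split=> //.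
by rewrite mem_cat map_f // mem_iota.
Qed.

Lemma subtype_bottom t : subtype table_arities table bottom_ty t -> t = bottom_ty.
Proof.
case E: _ _ / => [A ts C ts' ts'' star eq_sz _]; move: star.
case: E => <- <- /inh_star_tableP[[<- ets]|/inh_tableP[g [x []]] //].
by move: eq_sz; rewrite -ets => /size0nil ->.
Qed.

Lemma accepts_subtype n a q b : symbols a -> symbols b -> q \in states ->
  accepts n (a, q, b) ->
  subtype table_arities table
    (word_ty a bottom_ty) (state_ty q (word_ty b bottom_ty)).
Proof.
elim: n a q b => //= n IHn [//|g a] q b /= /andP[lt_g3 a_sym] b_sym qs acc.
have wf_a : wf table_arities (word_ty a bottom_ty) by apply: wf_word_ty.
apply: subtype_move => //; have := deltaP lt_g3 qs.
case: (delta g q) acc => [[q' p] acc|].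
  case/andP=> q's p_sym; rewrite /= -word_ty_cat.
  by apply: IHn; rewrite // /symbols all_cat; apply/andP; split.
case: b b_sym => // h b /andP[lt_h3 b_sym] _ _.
by apply: subtype_accept => //; apply: wf_word_ty.
Qed.

Lemma subtype_accepts a q b : symbols a -> symbols b -> q \in states ->
  subtype table_arities table
    (word_ty a bottom_ty) (state_ty q (word_ty b bottom_ty)) ->
  exists n, accepts n (a, q, b).
Proof.
move=> a_sym b_sym qs sub.
(* Both types become variables tied by equations, so that the induction on the derivation can
   exchange the stacks. *)
move et: (word_ty a _) sub => t sub; move eu: (state_ty q _) sub => u sub.
elim: sub a q b a_sym b_sym qs et eu => {t u}.
move=> A ts C ts' ts'' star _ sub IH a q b a_sym b_sym qs et [eC ets].
case: a a_sym et => [_ [eA eb]|g a /andP[lt_g3 a_sym] /= [eA eb]].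
  case/inh_star_tableP: star => [[eAC _]|/inh_tableP[g [x [_ [eAg _] _]]]].
    by move: eAC; rewrite -eA -eC.
  by move: eAg; rewrite -eA.
case/inh_star_tableP: star => [[eAC _]|].
  by move: lt_g3; rewrite -ltnS eA eAC -eC.
case/inh_tableP=> g' [x [_ []]]; rewrite -eA -eb => -[<-] [<-] [[eC4 _]|].
  by move: eC4; rewrite -eC.
case=> q' q's []; rewrite -eC => /state_class_inj-> // ets'.
(* The only premise, at index 0, is the goal with the stacks exchanged. *)
move: sub IH; rewrite ets' -ets => /(_ 0 isT) /= sub /(_ 0 isT) /= IH.
have := deltaP lt_g3 q's.
case E: (delta g q') sub IH => [[q2 p]|] /= sub IH.
  case/andP=> q2s p_sym.
  have pa_sym : symbols (p ++ a) by rewrite /symbols all_cat; apply/andP; split.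
  have [|n acc] := IH b q2 (p ++ a) b_sym pa_sym q2s erefl.
    by rewrite word_ty_cat.
  by exists n.+1; rewrite /= E.
(* An empty [b] would leave [bottom_ty] below [accept_ty], but [bottom_ty] is below itself only. *)
move=> _; exists 1; rewrite /= E; case: b sub {b_sym ets IH} => // sub.
by have := subtype_bottom sub.
Qed.

End Automaton.

(** * Minsky machines on two stacks *)

Definition store := nat -> nat.

Definition upd (s : store) (r v : nat) : store :=
  fun i => if i == r then v else s i.

(** Stores are total functions, so register lists that differ only by trailing zeros are
    identified. *)
Definition fstep (P : program) (c : nat * store) : nat * store :=
  let: (pc, s) := c in
  if pc < size P then
    match nth (INC 0 0) P pc with
    | INC r j => (j, upd s r (s r).+1)
    | DEC r j k => if s r is n.+1 then (j, upd s r n) else (k, s)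
    end
  else c.

Lemma iter_mstepE (P : program) (k pc : nat) (regs : seq nat) :
  iter k (fstep P) (pc, reg regs) =
  ((iter k (mstep P) (pc, regs)).1, reg (iter k (mstep P) (pc, regs)).2).
Proof.
have upd_reg l r v : reg (set_nth 0 l r v) = upd (reg l) r v.
  by apply: functional_extensionality => i; rewrite /reg /upd nth_set_nth.
elim: k => //= k ->; case: (iter k _ _) => {}pc {}regs /=.
case: ifP => // _; case: nth => [r j|r j h] /=; first by rewrite upd_reg.
by case: (reg regs r) => //= n; rewrite upd_reg.
Qed.

Definition halts (P : program) (n : nat) : Prop :=
  exists k, size P <= (iter k (fstep P) (0, reg [:: n])).1.

Definition instr_reg (i : instr) : nat :=
  match i with INC r _ => r | DEC r _ _ => r end.

Section Simulation.

Context (P : program).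

(* A state (fwd, c, (i, j)): program counter i; j separators still to be
   crossed while moving forward; c is the symbol in transit between the two
   stacks. *)
Definition sim_state : Type := (bool * option nat * (nat * nat))%type.

Definition fwd (i j : nat) : sim_state := (true, None, (i, j)).
(** Every program counter from [size P] on means halting; capping it there keeps the set of states
    finite. *)
Definition bwd (i : nat) : sim_state := (false, None, (minn i (size P), 0)).

(* Symbol 0 is a unit, 1 closes a register, 2 is the bottom of a stack, which
   also stands for infinitely many empty registers. *)
Definition sim_delta (g : nat) (q : sim_state) : option (sim_state * seq nat) :=
  match q with
  | (d, Some c, ij) => Some ((d, None, ij), [:: c; g])
  | (false, None, (i, _)) =>
      if g != 2 then Some ((false, Some g, (i, 0)), [::])
      else if i < size P then
        Some (fwd i (instr_reg (nth (INC 0 0) P i)), [:: 2])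
      else None
  | (true, None, (i, j.+1)) =>
      match g with
      | 0 => Some ((true, Some 0, (i, j.+1)), [::])
      | 1 => Some ((true, Some 1, (i, j)), [::])
      | _ => Some ((true, Some 1, (i, j)), [:: g])
      end
  | (true, None, (i, 0)) =>
      match nth (INC 0 0) P i with
      | INC _ k => Some (bwd k, if g is 2 then [:: 0; 1; 2] else [:: 0; g])
      | DEC _ k h => Some (if g is 0 then (bwd k, [::]) else (bwd h, [:: g]))
      end
  end.

Definition max_reg : nat := \max_(i <- P) instr_reg i.

(** [bwd 0] is put first, although it occurs again later, so that the start state is class 5 for
    every machine. The goal type is then the same for all [P]. *)
Definition sim_states : seq sim_state :=
  bwd 0 ::
  [seq (dc, ij) | dc <- [seq (d, c) | d <- [:: false; true],
                                      c <- None :: map Some (iota 0 3)],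
                  ij <- [seq (i, j) | i <- iota 0 (size P).+1,
                                      j <- iota 0 max_reg.+1]].

Lemma mem_pairs (T U : eqType) (s : seq T) (t : seq U) x y :
  ((x, y) \in [seq (x, y) | x <- s, y <- t]) = (x \in s) && (y \in t).
Proof.
apply/allpairsP/andP => [[[x' y'] [xs yt [-> ->]]] //|[xs yt]].
by exists (x, y).
Qed.

Lemma sim_statesP (d : bool) (c : option nat) (i j : nat) :
  ((d, c, (i, j)) \in sim_states) =
  [&& (if c is Some g then g < 3 else true), i <= size P & j <= max_reg].
Proof.
rewrite inE !mem_pairs !mem_iota !add0n !ltnS.
have -> : d \in [:: false; true] by case: d.
have -> : (c \in None :: map Some (iota 0 3)) = if c is Some g then g < 3 else true.
  by case: c => [[|[|[|g]]]|].
by case: eqP => // -[_ -> -> ->]; rewrite geq_minr.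
Qed.

Lemma bwd_states (i : nat) : bwd i \in sim_states.
Proof. by rewrite /bwd sim_statesP geq_minr. Qed.

Lemma nth_max_reg (i : nat) : i < size P ->
  instr_reg (nth (INC 0 0) P i) <= max_reg.
Proof.
move=> lt_iP; rewrite /max_reg (big_nth (INC 0 0)) big_mkord.
exact: (leq_bigmax (Ordinal lt_iP)).
Qed.

Lemma sim_deltaP (g : nat) (q : sim_state) : g < 3 -> q \in sim_states ->
  if sim_delta g q is Some (q', p) then (q' \in sim_states) && symbols p else true.
Proof.
case: q => [[d [c|]] [i j]] lt_g3; rewrite sim_statesP => /and3P[/= lt_c3 le_i le_j].
  by case: d; rewrite /= sim_statesP le_i le_j lt_c3 lt_g3.
case: d j le_j => [[|j]|j] le_j.
- rewrite /=; case: nth => [r k|r k h].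
    by rewrite bwd_states; case: g lt_g3 => [|[|[]]].
  by case: g lt_g3 => [|[|[]]] //=; rewrite bwd_states.
- case: g lt_g3 => [|[|[]]] //= _;
    by rewrite sim_statesP /= le_i ?le_j ?(ltnW le_j).
case: (g =P 2) => [->|_] /=; last by rewrite sim_statesP lt_g3 le_i.
by case: ifP => // lt_i; rewrite /fwd sim_statesP le_i nth_max_reg.
Qed.

(** * Runs of the simulating automaton *)

(** Taking [k] steps is expressed as an equality of acceptance with shifted fuel, which can be used
    in both directions of the simulation. *)
Definition reach (c c' : seq nat * sim_state * seq nat) : Prop :=
  exists k, forall n, accepts sim_delta (k + n) c = accepts sim_delta n c'.

Lemma reach_refl c : reach c c.
Proof. by exists 0. Qed.

Lemma reach_step g a q b q' p c : sim_delta g q = Some (q', p) ->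
  reach (b, q', p ++ a) c -> reach (g :: a, q, b) c.
Proof. by move=> E [k reach_c]; exists k.+1 => n /=; rewrite E. Qed.

Lemma reach_trans c1 c2 c3 : reach c1 c2 -> reach c2 c3 -> reach c1 c3.
Proof.
by move=> [k E1] [h E2]; exists (k + h) => n; rewrite -addnA E1 E2.
Qed.

Definition block (x : nat) : seq nat := rcons (nseq x 0) 1.
Definition blocks (l : seq nat) : seq nat := flatten (map block l).
Definition regs_word (l : seq nat) : seq nat := blocks l ++ [:: 2].

(** These are the registers crossed on the way to register [j]; those beyond the end of the list are
    created as zeros. *)
Fixpoint pad (j : nat) (l : seq nat) : seq nat :=
  if j is j'.+1 then head 0 l :: pad j' (behead l) else [::].

Lemma nth_pad_cons j l v i :
  nth 0 (pad j l ++ v :: behead (drop j l)) i = if i == j then v else nth 0 l i.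
Proof.
elim: j l i => [|j IHj] [|x l] [|i] //=; rewrite ?drop0 //.
- by rewrite nth_nil.
- by have := IHj [::] i; rewrite /= eqSS nth_nil.
Qed.

Lemma nth_pad_drop j l i : nth 0 (pad j l ++ drop j l) i = nth 0 l i.
Proof.
elim: j l i => [|j IHj] [|x l] [|i] //=; rewrite ?drop0 //.
by have := IHj [::] i; rewrite /= nth_nil.
Qed.

Lemma nth_drop_head j l : nth 0 l j = head 0 (drop j l).
Proof. by rewrite -nth0 nth_drop addn0. Qed.

(** Because of the exchange, carrying one symbol across takes two steps: pop it, then pop the top of
    the other stack and push both back. Hence [b] must be nonempty. *)
Lemma reach_block i j x a b : b != [::] ->
  reach (block x ++ a, fwd i j.+1, b) (a, fwd i j, catrev (block x) b).
Proof.
elim: x b => [|x IHx] [//|h b] _ /=; do 2!apply: reach_step => //=.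
  exact: reach_refl.
exact: IHx.
Qed.

Lemma reach_fwd i j l b : b != [::] ->
  reach (regs_word l, fwd i j, b)
        (regs_word (drop j l), fwd i 0, catrev (blocks (pad j l)) b).
Proof.
elim: j l b => [|j IHj] l b b0; first by rewrite drop0; apply: reach_refl.
case: l => [|x l] /=.
  (* At the bottom symbol an empty block is created: 2 is put back and a 1 is carried across. *)
  case: b b0 => // h b _; do 2!apply: reach_step => //=.
  by have := IHj [::]; rewrite /=; apply.
rewrite /regs_word /blocks /= -catA.
apply: reach_trans (reach_block _ _ _ _ b0) _; rewrite -/(blocks _) catrev_catl.
by apply: IHj; rewrite catrevE; case: b b0 => // h b _; case: (rev _).
Qed.

Lemma reach_bwd i v a : a != [::] -> all (fun g => g < 2) v ->
  reach (v ++ [:: 2], bwd i, a) ([:: 2], bwd i, catrev v a).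
Proof.
elim: v a => [|g v IHv] a a0 /=; first by move=> _; apply: reach_refl.
case/andP=> lt_g2 v2; case: a a0 => // h a _.
apply: reach_step => /=; first by case: g lt_g2 => [|[]].
by apply: reach_step => //=; apply: (IHv (g :: h :: a)).
Qed.

Definition config (pc : nat) (l : seq nat) : seq nat * sim_state * seq nat :=
  ([:: 2], bwd pc, regs_word l).

Lemma regs_word_cat l l' : regs_word (l ++ l') = blocks l ++ regs_word l'.
Proof. by rewrite /regs_word /blocks map_cat flatten_cat catA. Qed.

Lemma regs_word_neq0 l : regs_word l != [::].
Proof. by rewrite /regs_word; case: blocks. Qed.

Lemma blocks_lt2 l : all (fun g => g < 2) (blocks l).
Proof.
by elim: l => //= x l IHl; rewrite all_cat IHl all_rcons all_nseq orbT.
Qed.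

Lemma symbols_regs_word l : symbols (regs_word l).
Proof.
rewrite /symbols all_cat andbT; apply: sub_all (blocks_lt2 l) => g.
exact: leqW.
Qed.

(** Crossing the first [j] blocks stacks them in reverse order. The single step that changes
    register [j] also exchanges the stacks, so the backward state starts on the reversed blocks and
    restores their order. *)
Lemma reach_instr i i' j l l2 :
  (forall b, b != [::] ->
     reach (regs_word (drop j l), fwd i 0, b) (b, bwd i', regs_word l2)) ->
  reach (regs_word l, fwd i j, [:: 2]) (config i' (pad j l ++ l2)).
Proof.
move=> reach2; have rev_blocks : catrev (blocks (pad j l)) [:: 2] != [::].
  by rewrite catrevE; case: (rev _).
apply: reach_trans (@reach_fwd i j l [:: 2] isT) _.
apply: reach_trans (reach2 _ rev_blocks) _; rewrite catrevE.
have := reach_bwd i' (v := rev (blocks (pad j l))) (regs_word_neq0 l2).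
by rewrite all_rev blocks_lt2 catrevE revK /config regs_word_cat; apply.
Qed.

Lemma reach_fstep pc s l : pc < size P -> nth 0 l =1 s ->
  exists l', nth 0 l' =1 (fstep P (pc, s)).2 /\
    reach (regs_word l, fwd pc (instr_reg (nth (INC 0 0) P pc)), [:: 2])
          (config (fstep P (pc, s)).1 l').
Proof.
move=> lt_pc eq_ls; rewrite /= lt_pc.
case E: (nth (INC 0 0) P pc) => [r j|r j h] /=.
  exists (pad r l ++ (s r).+1 :: behead (drop r l)); split=> [i|].
    by rewrite nth_pad_cons eq_ls.
  apply: reach_instr => b _; rewrite -eq_ls nth_drop_head.
  have step g : sim_delta g (fwd pc 0) =
      Some (bwd j, if g is 2 then [:: 0; 1; 2] else [:: 0; g]) by rewrite /= E.
  (* The block of the register is absent, empty or nonempty; an absent one is created with one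
     unit. *)
  by case: (drop r l) => [|[|x] t]; apply: reach_step (step _) (reach_refl _).
have step0 : sim_delta 0 (fwd pc 0) = Some (bwd j, [::]) by rewrite /= E.
have stepS g : sim_delta g.+1 (fwd pc 0) = Some (bwd h, [:: g.+1]) by rewrite /= E.
case sr: (s r) => [|n] /=.
  exists (pad r l ++ drop r l); split=> [i|]; first by rewrite nth_pad_drop eq_ls.
  apply: reach_instr => b _; move: sr; rewrite -eq_ls nth_drop_head.
  (* A zero register shows 1 or 2 on top, and that symbol is put back. *)
  by case: (drop r l) => [|[|x] t] // _; apply: reach_step (stepS _) (reach_refl _).
exists (pad r l ++ n :: behead (drop r l)); split=> [i|].
  by rewrite nth_pad_cons eq_ls.
apply: reach_instr => b _; move: sr; rewrite -eq_ls nth_drop_head.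
case: (drop r l) => [|x t] //; rewrite [head _ _]/= => ->.
exact: reach_step step0 (reach_refl _).
Qed.

Lemma accepts_halts pc s l : nth 0 l =1 s ->
  (exists n, accepts sim_delta n (config pc l)) <->
  exists k, size P <= (iter k (fstep P) (pc, s)).1.
Proof.
have start pc' l' n : pc' < size P -> accepts sim_delta n.+1 (config pc' l') =
    accepts sim_delta n
      (regs_word l', fwd pc' (instr_reg (nth (INC 0 0) P pc')), [:: 2]).
  move=> lt_pc; rewrite /= /minn lt_pc lt_pc //.
have halted pc' l' : size P <= pc' -> accepts sim_delta 1 (config pc' l').
  move=> le_pc; rewrite /= (minn_idPr le_pc) ltnn regs_word_neq0 //.
move=> eq_ls; split=> -[n].
  elim/ltn_ind: n pc s l eq_ls => n IHn pc s l eq_ls acc.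
  have [lt_pc|le_pc] := ltnP pc (size P); last by exists 0.
  case: n IHn acc => [|n] IHn; rewrite ?start // => acc.
  have [l' [eq_l' [k reach_l']]] := reach_fstep lt_pc eq_ls.
  have [lt_nk|le_kn] := ltnP n k.
    (* If the fuel ran out within this instruction, the configuration after it would be accepted
       with fuel 0. *)
    by move: (accepts_leq (ltnW lt_nk) acc); rewrite -[k]addn0 reach_l'.
  move: acc; rewrite -(subnKC le_kn) reach_l' => acc.
  have [|m] := IHn (n - k) _ _ _ _ eq_l' acc; first by rewrite ltnS leq_subr.
  by rewrite -surjective_pairing -iterSr; exists m.+1.
elim: n pc s l eq_ls => [|n IHn] pc s l eq_ls.
  by move=> le_pc; exists 1; apply: halted.
have [lt_pc|le_pc] := ltnP pc (size P); last by exists 1; apply: halted.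
have [l' [eq_l' [k reach_l']]] := reach_fstep lt_pc eq_ls.
rewrite iterSr [fstep P _]surjective_pairing => /(IHn _ _ _ eq_l')[m acc].
by exists (k + m).+1; rewrite start // reach_l'.
Qed.

End Simulation.

(** * Counting loops and the encoding of instances *)

Definition halting_instance (P : program) (n : nat) : instance :=
  (table_arities (sim_states P), table (sim_states P) (sim_delta P),
   word_ty [:: 2] bottom_ty,
   state_ty (sim_states P) (bwd P 0) (word_ty (regs_word [:: n]) bottom_ty)).

Lemma halting_instance_valid P n : valid_instance (halting_instance P n).
Proof.
have deltaP := @sim_deltaP P; split.
- exact: wf_table_table deltaP.
- exact: no_MII_table.
- by rewrite /ground tvars_word_ty andbT; apply: wf_word_ty.
- apply/andP; split; last by rewrite /ground /= tvars_word_ty.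
  apply: wf_state_ty (bwd_states P 0) _.
  by apply: wf_word_ty => //; apply: symbols_regs_word.
Qed.

Lemma halting_instance_holds P n :
  subtype_holds (halting_instance P n) <-> halts P n.
Proof.
have init : nth 0 [:: n] =1 reg [:: n] by [].
apply: iff_trans (accepts_halts P 0 init); split=> [|[k acc]].
  apply: subtype_accepts (bwd_states P 0) => //; first exact: sim_deltaP.
  exact: symbols_regs_word.
apply: accepts_subtype acc => //; first exact: sim_deltaP.
  exact: symbols_regs_word.
exact: bwd_states.
Qed.

(** * A language of counting loops and its compilation *)

Inductive loop : Type :=
| Skip
| Inc of nat
| Seq of loop & loop
| Loop of nat & loop.

Fixpoint denote (c : loop) (s : store) : store :=
  match c with
  | Skip => s
  | Inc r => upd s r (s r).+1
  | Seq c1 c2 => denote c2 (denote c1 s)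
  | Loop r c => iter (s r) (fun s => denote c (upd s r (s r).-1)) s
  end.

Fixpoint writes (c : loop) : seq nat :=
  match c with
  | Skip => [::]
  | Inc r => [:: r]
  | Seq c1 c2 => writes c1 ++ writes c2
  | Loop r c => r :: writes c
  end.

(* A loop body may not touch its counter, so [denote] counts correctly. *)
Fixpoint wf_loop (c : loop) : bool :=
  match c with
  | Seq c1 c2 => wf_loop c1 && wf_loop c2
  | Loop r c => (r \notin writes c) && wf_loop c
  | _ => true
  end.

Fixpoint csize (c : loop) : nat :=
  match c with
  | Skip => 0
  | Inc _ => 1
  | Seq c1 c2 => csize c1 + csize c2
  | Loop _ c => (csize c).+2
  end.

(* Jumps are absolute, so code is generated for a given offset; the counter is
   tested both before the body and after it, since there is no plain jump. *)
Fixpoint compile (off : nat) (c : loop) : program :=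
  match c with
  | Skip => [::]
  | Inc r => [:: INC r off.+1]
  | Seq c1 c2 => compile off c1 ++ compile (off + csize c1) c2
  | Loop r c =>
      let test := DEC r off.+1 (off + (csize c).+2) in
      test :: rcons (compile off.+1 c) test
  end.

Lemma denote_Seq c d s : denote (Seq c d) s = denote d (denote c s).
Proof. by []. Qed.

Lemma size_compile off c : size (compile off c) = csize c.
Proof.
elim: c off => //= [c1 IH1 c2 IH2|r c IHc] off; first by rewrite size_cat IH1 IH2.
by rewrite size_rcons IHc.
Qed.

Lemma denote_writes c s r : r \notin writes c -> denote c s r = s r.
Proof.
elim: c s => //= [q|c1 IH1 c2 IH2|q c IHc] s.
- by rewrite inE /upd => /negPf->.
- by rewrite mem_cat negb_or => /andP[w1 w2]; rewrite IH2 // IH1.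
rewrite inE negb_or => /andP[/negPf neq_rq wc].
by elim: (s q) => //= n <-; rewrite IHc // /upd neq_rq.
Qed.

Definition code_at (P : program) (off : nat) (c : program) : Prop :=
  exists pre post, P = pre ++ c ++ post /\ size pre = off.

Lemma code_at_cat P off c1 c2 : code_at P off (c1 ++ c2) ->
  code_at P off c1 /\ code_at P (off + size c1) c2.
Proof.
case=> pre [post [-> <-]]; split; first by exists pre, (c2 ++ post); rewrite -catA.
by exists (pre ++ c1), post; rewrite -!catA size_cat.
Qed.

Lemma code_at_cons P off i c : code_at P off (i :: c) ->
  [/\ off < size P, nth (INC 0 0) P off = i & code_at P off.+1 c].
Proof.
case=> pre [post [-> <-]]; split.
- by rewrite size_cat -addn1 leq_add2l.
- by rewrite nth_cat ltnn subnn.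
by exists (rcons pre i), post; rewrite cat_rcons size_rcons.
Qed.

Definition runs (P : program) (c c' : nat * store) : Prop :=
  exists k, iter k (fstep P) c = c'.

Lemma runs_trans P c1 c2 c3 : runs P c1 c2 -> runs P c2 c3 -> runs P c1 c3.
Proof. by move=> [k E1] [h E2]; exists (h + k); rewrite iterD E1. Qed.

Lemma runs_step P c c' : runs P (fstep P c) c' -> runs P c c'.
Proof. by case=> k E; exists k.+1; rewrite iterSr. Qed.

Lemma runs_compile P c off s : wf_loop c -> code_at P off (compile off c) ->
  runs P (off, s) (off + csize c, denote c s).
Proof.
elim: c off s => [|r|c1 IH1 c2 IH2|r c IHc] off s /=.
- by move=> _ _; exists 0; rewrite addn0.
- move=> _ /code_at_cons[lt_P E _]; exists 1.
  by rewrite /= lt_P E addn1.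
- case/andP=> wf1 wf2 /code_at_cat[at1]; rewrite size_compile => at2.
  by apply: runs_trans (IH1 _ _ wf1 at1) _; rewrite addnA; apply: IH2.
case/andP=> wr wf_c /code_at_cons[lt_P E]; rewrite -cats1 => /code_at_cat[at_c].
rewrite size_compile => /code_at_cons[lt_P' E' _].
set exit := off + _ in E E' *.
(* The test stands before and after the body; the induction on the counter may start from either
   copy. *)
suff loop_runs n s' pc : pc < size P -> nth (INC 0 0) P pc = DEC r off.+1 exit ->
    s' r = n ->
    runs P (pc, s')
      (exit, iter n (fun s => denote c (upd s r (s r).-1)) s') by exact: loop_runs.
elim: n s' pc => [|n IHn] s' pc lt_pc Epc s'r; apply: runs_step.
  by rewrite /= lt_pc Epc s'r; exists 0.
rewrite iterSr s'r /= lt_pc Epc s'r.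
apply: runs_trans (IHc _ _ wf_c at_c) _.
by apply: IHn => //; rewrite denote_writes // /upd eqxx.
Qed.

(** * Arithmetic by counting loops *)

Lemma upd_nth xs r v : upd (nth 0 xs) r v = nth 0 (set_nth 0 xs r v).
Proof. by apply: functional_extensionality => i; rewrite /upd nth_set_nth. Qed.

Lemma upd_upd s r v w : upd (upd s r v) r w = upd s r w.
Proof. by apply: functional_extensionality => i; rewrite /upd; case: eqP. Qed.

Lemma upd_id s r : upd s r (s r) = s.
Proof. by apply: functional_extensionality => i; rewrite /upd; case: eqP => // ->. Qed.

Lemma upd_comm s r q v w : r != q -> upd (upd s r v) q w = upd (upd s q w) r v.
Proof.
move=> neq_rq; apply: functional_extensionality => i; rewrite /upd.
by case: eqP => // ->; rewrite eq_sym (negPf neq_rq).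
Qed.

(* Register 1 is the accumulator of all computations, register 2 is scratch
   space containing 0. *)
Definition computes (c : loop) (f : nat -> nat) : Prop :=
  forall s, s 2 = 0 -> denote c s = upd s 1 (f (s 1)).

Lemma computes_loop c f r s : computes c f -> r \notin [:: 1; 2] -> s 2 = 0 ->
  denote (Loop r c) s = upd (upd s 1 (iter (s r) f (s 1))) r 0.
Proof.
move=> cf; rewrite !inE negb_or => /andP[r1 r2] s2 /=.
elim: (s r) {-2}s (erefl (s r)) s2 => [|n IHn] {}s sr s2.
  by rewrite sr /= upd_id -sr upd_id.
rewrite sr iterSr sr [n.+1.-1]/= cf; last by rewrite /upd eq_sym (negPf r2).
set s' := upd _ 1 _; have s'r : s' r = n by rewrite /s' /upd (negPf r1) eqxx.
have := IHn s' s'r; rewrite s'r => ->; last by rewrite /s' /upd /= eq_sym (negPf r2).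
rewrite /s' upd_upd [X in iter _ _ X]/upd eqxx -iterSr [X in iter _ _ X]/upd.
by rewrite eq_sym (negPf r1) (upd_comm _ _ _ r1) upd_upd.
Qed.

Definition Double : loop := Seq (Loop 1 (Seq (Inc 2) (Inc 2))) (Loop 2 (Inc 1)).

Lemma denote_add_loop c a b m s : a != b ->
  (forall s, denote c s = upd s b (s b + m)) ->
  denote (Loop a c) s = upd (upd s b (s b + s a * m)) a 0.
Proof.
move=> neq_ab cE /=.
elim: (s a) {-2}s (erefl (s a)) => [|n IHn] {}s sa.
  by rewrite sa mul0n addn0 /= upd_id -sa upd_id.
rewrite sa iterSr sa cE [n.+1.-1]/=.
set s' := upd _ b _; have s'a : s' a = n by rewrite /s' /upd (negPf neq_ab) eqxx.
have := IHn s' s'a; rewrite s'a => ->.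
rewrite /s' upd_upd [X in upd _ b (X + _)]/upd eqxx.
rewrite [X in X + m + _]/upd eq_sym (negPf neq_ab) -addnA -mulSn.
by rewrite (upd_comm _ _ _ neq_ab) upd_upd.
Qed.

Definition Move (a b : nat) : loop := Loop a (Inc b).

Lemma denote_Move a b xs : a != b ->
  denote (Move a b) (nth 0 xs) =
  nth 0 (set_nth 0 (set_nth 0 xs b (nth 0 xs b + nth 0 xs a)) a 0).
Proof.
move=> neq_ab; rewrite (@denote_add_loop _ _ b 1) // => [|s]; last by rewrite addn1.
by rewrite muln1 !upd_nth.
Qed.

Lemma computes_Double : computes Double double.
Proof.
move=> s s2 /=; rewrite -[iter (s 1) _ s]/(denote (Loop 1 (Seq (Inc 2) (Inc 2))) s).
rewrite (@denote_add_loop _ _ 2 2) // => [|s']; last first.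
  by rewrite /= upd_upd /upd eqxx addn2.
rewrite s2 add0n muln2; set t := upd _ 1 0.
rewrite -[iter _ _ t]/(denote (Loop 2 (Inc 1)) t).
rewrite (@denote_add_loop _ _ 1 1) // => [|s']; last by rewrite addn1.
have [-> ->] : t 1 = 0 /\ t 2 = (s 1).*2 by [].
rewrite muln1 add0n; apply: functional_extensionality => i; rewrite /t /upd.
by case: (i =P 2) => [->|_] //; case: (i =P 1).
Qed.

Lemma computes_Seq c d f g : computes c f -> computes d g ->
  computes (Seq c d) (g \o f).
Proof.
move=> cf dg s s2 /=; rewrite cf // dg; last by rewrite /upd.
by rewrite upd_upd [X in upd s 1 (g X)]/upd.
Qed.

Lemma computes_Inc : computes (Inc 1) succn.
Proof. by []. Qed.

(** This is the code of a list with head [m] and tail coded by [x] in the encoding of sequences of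
    numbers underlying [pickle]. *)
Definition push (m x : nat) : nat := 2 ^ m * x.*2.+1.

Lemma iter_double m x : iter m double x = 2 ^ m * x.
Proof.
by elim: m => [|m IHm]; rewrite ?mul1n // iterS IHm -mul2n mulnA -expnS.
Qed.

Definition Succ_double : loop := Seq Double (Inc 1).

Lemma computes_Succ_double : computes Succ_double (fun x => x.*2.+1).
Proof. exact: computes_Seq computes_Double computes_Inc. Qed.

Definition Push (m : nat) : loop := Seq Succ_double (iter m (Seq Double) Skip).

Lemma computes_Push m : computes (Push m) (push m).
Proof.
have pow : computes (iter m (Seq Double) Skip) (fun x => 2 ^ m * x).
  elim: m => [|m IHm] s s2; first by rewrite /= mul1n upd_id.
  rewrite (computes_Seq computes_Double IHm s2) /= expnSr -mulnA.
  by rewrite mul2n.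
exact: computes_Seq computes_Succ_double pow.
Qed.

Definition Push_all (ms : seq nat) : loop :=
  foldr (fun m c => Seq c (Push m)) Skip ms.

Lemma computes_Push_all ms : computes (Push_all ms) (fun x => foldr push x ms).
Proof.
elim: ms => [|m ms IHms] s s2; first by rewrite /= upd_id.
by rewrite (computes_Seq IHms (computes_Push m) s2).
Qed.

(** Stores are displayed as lists, accumulator second and scratch third, so that later updates
    reduce by computation. *)
Lemma denote_computes c f a x l : computes c f ->
  denote c (nth 0 [:: a, x, 0 & l]) = nth 0 [:: a, f x, 0 & l].
Proof. by move=> cf; rewrite cf // upd_nth. Qed.

Lemma denote_loop c f r a x l : computes c f ->
  denote (Loop r.+3 c) (nth 0 [:: a, x, 0 & l]) =
  nth 0 [:: a, iter (nth 0 l r) f x, 0 & set_nth 0 l r 0].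
Proof.
by move=> cf; rewrite (computes_loop cf) // !upd_nth.
Qed.

Definition Push_reg (r : nat) : loop := Seq Succ_double (Loop r Double).

Lemma denote_Push_reg r a x l :
  denote (Push_reg r.+3) (nth 0 [:: a, x, 0 & l]) =
  nth 0 [:: a, push (nth 0 l r) x, 0 & set_nth 0 l r 0].
Proof.
rewrite /Push_reg denote_Seq (denote_computes _ _ _ computes_Succ_double).
by rewrite (denote_loop _ _ _ _ computes_Double) iter_double.
Qed.

Definition Seqs (cs : seq loop) : loop := foldr Seq Skip cs.

(** * The loop that computes the code of an instance *)

Section Encoder.

Context (before unary bottom after : nat) (middle : seq nat).

(** Here [n] serves twice: as the code of arities and class table, and as the machine input inside
    the code [T] of the goal type. [bottom] is the code of the left type. *)
Definition encoded (n : nat) : nat :=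
  let T := push before (iter n (push unary)
             (foldr push (iter n (push after) (push after 0)) middle)) in
  push (push n (push bottom 0)) (push T 0).

(** Loops clear their counter, so the input is copied: register 3 counts the closing symbols, 4 the
    units, and 5 keeps the code of the table. Registers 3 and 4 are then reused for partial results.
    The result goes to register 6, where the decider reads its input. *)
Definition Encode : loop := Seqs
  [:: Loop 0 (Seq (Inc 3) (Seq (Inc 4) (Inc 5)));
      Push after; Loop 3 (Push after); Push_all middle; Loop 4 (Push unary);
      Push before; Move 1 3; Push_reg 3; Move 1 3;
      Push bottom; Push_reg 5; Move 1 4; Move 3 1; Push_reg 4; Move 1 6].

Lemma denote_Encode n :
  denote Encode (nth 0 [:: n]) = nth 0 [:: 0; 0; 0; 0; 0; 0; encoded n].
Proof.
(* All seven registers are listed explicitly so that [set_nth] computes. *)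
have -> : nth 0 [:: n] = nth 0 [:: n; 0; 0; 0; 0; 0; 0].
  by apply: functional_extensionality => -[|[|[|[|[|[|[|i]]]]]]] //=; rewrite !nth_nil.
rewrite /Encode /Seqs /foldr 15!denote_Seq.
have -> : denote (Loop 0 (Seq (Inc 3) (Seq (Inc 4) (Inc 5))))
    (nth 0 [:: n; 0; 0; 0; 0; 0; 0]) = nth 0 [:: 0; 0; 0; n; n; n; 0].
  have copy m x y z : iter m (fun s => denote (Seq (Inc 3) (Seq (Inc 4) (Inc 5)))
      (upd s 0 (s 0).-1)) (nth 0 [:: m; 0; 0; x; y; z; 0]) =
      nth 0 [:: 0; 0; 0; m + x; m + y; m + z; 0].
    elim: m x y z => // m IHm x y z.
    by rewrite iterSr /= !upd_nth /= IHm !addnS !addSn.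
  by rewrite [denote _ _]/= copy !addn0.
have push_push := computes_Push; have all_push := computes_Push_all.
rewrite !(denote_computes _ _ _ (push_push _)).
rewrite (denote_loop 0 _ _ _ (push_push _)) (denote_computes _ _ _ (all_push _)).
rewrite (denote_loop 1 _ _ _ (push_push _)) (denote_computes _ _ _ (push_push _)).
cbn [set_nth nth]; rewrite denote_Move // denote_Push_reg.
cbn [set_nth nth]; rewrite add0n denote_Move // (denote_computes _ _ _ (push_push _)).
cbn [set_nth nth]; rewrite add0n denote_Push_reg.
do 2!(cbn [set_nth nth]; rewrite denote_Move //).
cbn [set_nth nth]; rewrite !add0n denote_Push_reg.
by cbn [set_nth nth]; rewrite denote_Move.
Qed.

End Encoder.

Lemma wf_Encode before unary bottom after middle :
  wf_loop (Encode before unary bottom after middle).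
Proof.
have notinP (r m : nat) : r.+3 \notin writes (Push m) by rewrite /=; elim: m.
have wfP m : wf_loop (Push m) by rewrite /=; elim: m.
have wfA ms : wf_loop (Push_all ms) by elim: ms => //= m ms ->; apply: wfP.
rewrite /Encode /Seqs /foldr.
have wfS c d : wf_loop (Seq c d) = wf_loop c && wf_loop d by [].
have wfL r c : wf_loop (Loop r c) = (r \notin writes c) && wf_loop c by [].
by rewrite 15!wfS !(wfL _ (Push _)) !notinP !wfP wfA.
Qed.

Definition symbol_code (x : nat + nat) : nat := pickle x.

(* In the pre-order code of the goal type, [inl C.+1] opens class C and [inl 0]
   closes it, so a stack of n units gives n times [inl 2] and n times [inl 0]
   around this fixed middle part. *)
Definition middle_codes : seq nat :=
  map symbol_code [:: inl 3; inl 4; inl 1; inl 0; inl 0; inl 0].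

Definition instance_loop : loop :=
  Encode (symbol_code (inl 6)) (symbol_code (inl 2))
    (pickle (word_ty [:: 2] bottom_ty)) (symbol_code (inl 0)) middle_codes.

Definition instance_code : nat -> nat :=
  encoded (symbol_code (inl 6)) (symbol_code (inl 2))
    (pickle (word_ty [:: 2] bottom_ty)) (symbol_code (inl 0)) middle_codes.

(** * Agreement of the encoder with [pickle] *)

Lemma pickle_pair (T U : countType) (x : T) (y : U) :
  pickle (x, y) = push (pickle x) (push (pickle y) 0).
Proof. by []. Qed.

Lemma pickle_ty (t : ty) :
  pickle t = foldr push 0 (map symbol_code (GenTree.encode (ty_enc t))).
Proof. by []. Qed.

Lemma rcons_nseq (T : Type) n (x : T) : rcons (nseq n x) x = nseq n.+1 x.
Proof. by elim: n => //= n ->. Qed.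

Lemma encode_word_ty w :
  GenTree.encode (ty_enc (word_ty w bottom_ty)) =
  map (fun g => inl g.+2) w ++ inl 1 :: nseq (size w).+1 (inl 0).
Proof.
elim: w => // g w IHw.
rewrite [GenTree.encode _]/= IHw cats0 rcons_cat rcons_cons rcons_nseq.
by [].
Qed.

Lemma foldr_nseq (T R : Type) (f : T -> R -> R) x n a :
  foldr f x (nseq n a) = iter n (f a) x.
Proof. by elim: n => //= n ->. Qed.

Lemma encode_goal_ty P n :
  GenTree.encode
    (ty_enc (state_ty (sim_states P) (bwd P 0) (word_ty (regs_word [:: n]) bottom_ty))) =
  inl 6 :: nseq n (inl 2) ++ [:: inl 3; inl 4; inl 1; inl 0; inl 0; inl 0] ++
    nseq n (inl 0) ++ [:: inl 0].
Proof.
have -> : regs_word [:: n] = nseq n 0 ++ [:: 1; 2].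
  by rewrite /regs_word /blocks /= cats0 /block -cats1 -catA.
rewrite [GenTree.encode _]/= encode_word_ty cats0 map_cat map_nseq rcons_cat -catA.
have -> : state_class (sim_states P) (bwd P 0) = 5 by rewrite /state_class /= eqxx.
rewrite rcons_cons rcons_nseq size_cat size_nseq addn2 cats1 rcons_nseq.
by [].
Qed.

Lemma pickle_goal_ty P n :
  pickle (state_ty (sim_states P) (bwd P 0) (word_ty (regs_word [:: n]) bottom_ty)) =
  push (symbol_code (inl 6)) (iter n (push (symbol_code (inl 2)))
    (foldr push (iter n (push (symbol_code (inl 0))) (push (symbol_code (inl 0)) 0))
       middle_codes)).
Proof.
rewrite pickle_ty encode_goal_ty map_cons !map_cat !map_nseq -/middle_codes.
have foldr_push_cons m ms : foldr push 0 (m :: ms) = push m (foldr push 0 ms) by [].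
by rewrite foldr_push_cons !foldr_cat !foldr_nseq.
Qed.

(** When the input is the code of the machine's own table, one number determines the whole instance,
    and [instance_code] does not mention [P]. *)
Lemma encode_halting_instance P n :
  n = pickle (table_arities (sim_states P), table (sim_states P) (sim_delta P)) ->
  encode (halting_instance P n) = instance_code n.
Proof.
move=> nE; rewrite /encode /halting_instance 2!pickle_pair pickle_goal_ty -nE.
by rewrite /instance_code /encoded.
Qed.

(** * Diagonalization *)

(** Jump targets are capped at [m], so that every way of halting leads to the first instruction
    after the copied program. *)
Definition shift_instr (r0 off m : nat) (i : instr) : instr :=
  match i with
  | INC r j => INC (r0 + r) (off + minn j m)
  | DEC r j k => DEC (r0 + r) (off + minn j m) (off + minn k m)
  end.

Lemma code_at_nth D off c i : code_at D off c -> i < size c ->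
  off + i < size D /\ nth (INC 0 0) D (off + i) = nth (INC 0 0) c i.
Proof.
case=> pre [post [-> <-]] lt_ic; rewrite !size_cat ltn_add2l ltn_addr //; split=> //.
by rewrite nth_cat ltnNge leq_addr /= addKn nth_cat lt_ic.
Qed.

Lemma runs_shift P D r0 off k pc f s :
  code_at D off (map (shift_instr r0 off (size P)) P) ->
  (forall r, s (r0 + r) = f r) ->
  exists2 s', runs D (off + minn pc (size P), s)
                (off + minn (iter k (fstep P) (pc, f)).1 (size P), s') &
    forall r, s' (r0 + r) = (iter k (fstep P) (pc, f)).2 r.
Proof.
move=> atP; elim: k pc f s => [|k IHk] pc f s eq_s; first by exists s => //; exists 0.
have upd_shift s' f' r v : (forall r, s' (r0 + r) = f' r) ->
    forall q, upd s' (r0 + r) v (r0 + q) = upd f' r v q.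
  by move=> eq_s' q; rewrite /upd eqn_add2l eq_s'.
rewrite iterSr.
suff [s1 run1 eq_s1] : exists2 s1,
    runs D (off + minn pc (size P), s)
      (off + minn (fstep P (pc, f)).1 (size P), s1) &
    forall r, s1 (r0 + r) = (fstep P (pc, f)).2 r.
  have [s2 run2 eq_s2] := IHk (fstep P (pc, f)).1 _ _ eq_s1.
  rewrite -surjective_pairing in run2 eq_s2.
  by exists s2 => //; apply: runs_trans run1 run2.
rewrite /=; case: ltnP => [lt_pc|le_pc]; last first.
  by exists s => //; exists 0; rewrite /= (minn_idPr le_pc).
have [|lt_D] := code_at_nth (i := pc) atP; first by rewrite size_map.
rewrite (nth_map (INC 0 0)) // => E.
case EP: (nth (INC 0 0) P pc) E => [r j|r j h] /= E.
  exists (upd s (r0 + r) (s (r0 + r)).+1); last first.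
    by move=> q; rewrite (upd_shift s f) ?eq_s.
  by apply: runs_step; rewrite /= lt_D E; exists 0.
case fr: (f r) => [|n].
  exists s => //; apply: runs_step; rewrite /= lt_D E eq_s fr.
  by exists 0.
exists (upd s (r0 + r) n); last exact: upd_shift.
by apply: runs_step; rewrite /= lt_D E eq_s fr; exists 0.
Qed.

Lemma halted_iter P k c : size P <= c.1 -> iter k (fstep P) c = c.
Proof.
move=> halted; elim: k => //= k ->; case: c halted => pc s /=.
by rewrite leqNgt => /negPf->.
Qed.

Lemma halts_runs P n c : runs P (0, reg [:: n]) c ->
  halts P n <-> exists k, size P <= (iter k (fstep P) c).1.
Proof.
case=> h <-; split=> -[k halted]; last by exists (k + h); rewrite iterD.
(* A halted machine stands still, so [h] more steps do no harm. *)
by exists k; rewrite -iterD addnC iterD halted_iter.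
Qed.

(* The final two instructions halt iff register 6 is 0. *)
Definition diagonal (P : program) (c : loop) : program :=
  let off := csize c + size P in
  compile 0 c ++ map (shift_instr 6 (csize c) (size P)) P ++
  [:: DEC 6 off.+1 off.+2; INC 6 off.+1].

Lemma halts_diagonal P c f n v : wf_loop c ->
  denote c (nth 0 [:: n]) = nth 0 [:: 0; 0; 0; 0; 0; 0; f n] ->
  halts_with P (f n) v -> halts (diagonal P c) n <-> v = 0.
Proof.
move=> wf_c cE [k [halted v_out]]; set D := diagonal P c.
have at_c : code_at D 0 (compile 0 c).
  by exists [::]; eexists; split.
have atP : code_at D (csize c) (map (shift_instr 6 (csize c) (size P)) P).
  exists (compile 0 c), [:: DEC 6 (csize c + size P).+1 (csize c + size P).+2;
                            INC 6 (csize c + size P).+1].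
  by rewrite size_compile.
have at_end : code_at D (csize c + size P)
    [:: DEC 6 (csize c + size P).+1 (csize c + size P).+2;
        INC 6 (csize c + size P).+1].
  exists (compile 0 c ++ map (shift_instr 6 (csize c) (size P)) P), [::].
  by rewrite cats0 -catA size_cat size_map size_compile.
have sizeD : size D = (csize c + size P).+2.
  by rewrite /D /diagonal !size_cat size_map size_compile /= addn2 addnS addnS.
have run_c := runs_compile (nth 0 [:: n]) wf_c at_c.
rewrite cE add0n in run_c.
have [//|s' runP eq_s'] := runs_shift k 0 (f := reg [:: f n]) atP
  (s := nth 0 [:: 0; 0; 0; 0; 0; 0; f n]).
rewrite min0n addn0 in runP; rewrite iter_mstepE /= in runP eq_s'.
rewrite (minn_idPr halted) in runP.
have {}v_out : s' 6 = v by rewrite -v_out -(eq_s' 0).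
apply: iff_trans (halts_runs (runs_trans run_c runP)) _.
have [lt1 E1 /code_at_cons[lt2 E2 _]] := code_at_cons at_end.
split=> [[h]|v0]; last first.
  by exists 1; rewrite /= lt1 E1 v_out v0 sizeD.
case: h => [|h]; first by rewrite sizeD /= leqNgt leqnSn.
rewrite iterSr /= lt1 E1 v_out; case: v {v_out} => // v.
rewrite leqNgt => /negP[]; move: (upd _ _ _) => s.
(* For a nonzero answer control reaches the last instruction, an increment that jumps to itself
   forever. *)
suff [s'' ->] : exists s'', iter h (fstep D) ((csize c + size P).+1, s) =
    ((csize c + size P).+1, s'') by [].
elim: h => [|h [s'' IHh]]; first by exists s.
by rewrite iterS IHh /= lt2 E2; eexists.
Qed.

Theorem theorem1 : ~ exists P : program, decides_subtyping P.
Proof.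
case=> P decP.
pose D := diagonal P instance_loop.
pose n := pickle (table_arities (sim_states D), table (sim_states D) (sim_delta D)).
have [dec1 dec0] := decP _ (halting_instance_valid D n).
rewrite (@encode_halting_instance D n) // in dec1 dec0.
have haltsD v : halts_with P (instance_code n) v -> halts D n <-> v = 0.
  exact: halts_diagonal (wf_Encode _ _ _ _ _) (denote_Encode _ _ _ _ _ n).
(* If the subtyping held, [P] would answer 1 and [D] would run forever, yet the subtyping says that
   [D] halts. *)
have no_halt : ~ subtype_holds (halting_instance D n).
  by move=> holds; move/halting_instance_holds/(haltsD _ (dec1 holds)): (holds).
(* So [P] answers 0, which makes [D] halt and the subtyping hold after all. *)
by apply: (no_halt); apply/halting_instance_holds/(haltsD _ (dec0 no_halt)).
Qed.
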